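(* Let $\mathcal{H}$ be a reproducing kernel Hilbert space on a non-empty set $\Omega$, let $T\in B(\mathcal{H})$, let $\mu\in[0,1]$, and let $\sigma_\mu$ be an interpolation path of a symmetric mean $\sigma$. Then, for $p\ge1$, $$\|T\|_{\sigma_\mu\text{-ber}}^p\le\sup_{\lambda\in\Omega}\left\{\left\langle\frac12\left(|T|^2+|T^*|^2\right)\hat k_\lambda,\hat k_\lambda\right\rangle^{\frac p2}\ \sigma_\mu\ \left(\langle|T|^2\hat k_\lambda,\hat k_\lambda\rangle\right)^{\frac p2}\right\}.$$
   Context: A reproducing kernel Hilbert space on $\Omega$ is a Hilbert space of complex-valued functions on $\Omega$ whose point evaluations are bounded; $k_\lambda$ is the reproducing kernel at $\lambda\in\Omega$ (assumed nonzero) and $\hat k_\lambda=k_\lambda/\|k_\lambda\|$. $B(\mathcal{H})$ is the algebra of bounded linear operators on $\mathcal{H}$, and $|T|=(T^*T)^{1/2}$. A mean is a continuous function $\sigma:[0,\infty)^2\to[0,\infty)$, written $a\sigma b$, monotone increasing in each variable, with $a\le a\sigma b\le b$ whenever $a\le b$, and $(\alpha a)\sigma(\alpha b)=\alpha(a\sigma b)$ for $\alpha>0$. It is symmetric if $a\sigma b=b\sigma a$. An interpolation path for a symmetric mean $\sigma$ is a family of means $\sigma_\mu$, $\mu\in[0,1]$, each increasing in each component, with $a\sigma_0b=b$, $a\sigma_1b=a$, $a\sigma_{1/2}b=a\sigma b$, and $(a\sigma_\mu b)\sigma(a\sigma_\nu b)=a\sigma_{\frac{\mu+\nu}2}b$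 for all $\mu,\nu\in[0,1]$, $a,b\ge0$. For $p\ge1$ and $\mu\in[0,1]$, the $\sigma_\mu$-Berezin norm (depending also on $p$) is $\|T\|_{\sigma_\mu\text{-ber}}=\sup_{\lambda\in\Omega}\left(|\langle T\hat k_\lambda,\hat k_\lambda\rangle|^p\,\sigma_\mu\,\|T\hat k_\lambda\|^p\right)^{1/p}$. *)

(* Defs.v *)
From HB Require Import structures.
From mathcomp Require Import all_boot all_order all_algebra.
From mathcomp Require Import all_classical all_reals all_analysis.
From mathcomp Require Import complex.

Set Implicit Arguments.
Unset Strict Implicit.
Unset Printing Implicit Defensive.

Import Order.TTheory GRing.Theory Num.Theory.
Import numFieldNormedType.Exports.

Local Open Scope classical_set_scope.
Local Open Scope ring_scope.

Definition bounded_map (K : numDomainType) (U V : normedZmodType K)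
    (f : U -> V) : Prop :=
  exists M : K, forall x : U, `|f x| <= M * `|x|.

(* The inner product is linear in its first argument and conjugate-linear in
   the second.  An element of the space is identified with the function
   [rk_eval f] on Omega, whence the injectivity of [rk_eval]. *)
Record rkhs (R : realType) (Omega : Type) := RKHS {
  rk_space :> completeNormedModType R[i];
  rk_dot : {dot rk_space for Num.conj};
  rk_normE : forall f : rk_space, `|f| ^+ 2 = rk_dot f f;
  rk_eval : rk_space -> Omega -> R[i];
  rk_eval_linear : forall (a : R[i]) (f g : rk_space) (lam : Omega),
    rk_eval (a *: f + g) lam = a * rk_eval f lam + rk_eval g lam;
  rk_eval_inj : injective rk_eval;
  rk_eval_bounded : forall lam : Omega,
    bounded_map (fun f : rk_space => rk_eval f lam)
}.

Section Operators.
Variables (R : realType) (Omega : Type) (H : rkhs R Omega).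

Definition dot (x y : H) : R[i] := @rk_dot R Omega H x y.

(* The Riesz representer of the evaluation at lam. *)
Definition rk_kernel (lam : Omega) : H :=
  xget (0 : H) [set k : H | forall f : H, rk_eval f lam = dot f k].

Definition rk_nkernel (lam : Omega) : H :=
  `|rk_kernel lam|^-1 *: rk_kernel lam.

Definition is_adjoint (T S : {linear H -> H}) : Prop :=
  bounded_map S /\ forall x y : H, dot (T x) y = dot x (S y).

(* For bounded T, [is_adjoint T] holds of exactly one S. *)
Definition adjoint (T : {linear H -> H}) : {linear H -> H} :=
  xget (\0 : {linear H -> H}) [set S | is_adjoint T S].

(* In the order of R[i], [0 <= z] says that z is real and nonnegative. *)
Definition positive_op (A : {linear H -> H}) : Prop :=
  bounded_map A /\ forall x : H, 0 <= dot (A x) x.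

(* For positive A, exactly one positive S satisfies S o S = A. *)
Definition sqrt_op (A : {linear H -> H}) : {linear H -> H} :=
  xget (\0 : {linear H -> H})
    [set S | positive_op S /\ forall x : H, S (S x) = A x].

Definition abs_op (T : {linear H -> H}) : {linear H -> H} :=
  sqrt_op (adjoint T \o T).

Definition sq_op (A : {linear H -> H}) : {linear H -> H} := A \o A.

End Operators.

(* Only the values s a b with 0 <= a and 0 <= b are relevant. *)
Record is_mean (R : realType) (s : R -> R -> R) : Prop := IsMean {
  mean_ge0 : forall a b, 0 <= a -> 0 <= b -> 0 <= s a b;
  mean_continuous :
    {within [set x : R * R | 0 <= x.1 /\ 0 <= x.2],
      continuous (fun x : R * R => s x.1 x.2)};
  mean_monol : forall a a' b, 0 <= a -> a <= a' -> 0 <= b -> s a b <= s a' b;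
  mean_monor : forall a b b', 0 <= a -> 0 <= b -> b <= b' -> s a b <= s a b';
  mean_between : forall a b, 0 <= a -> a <= b -> a <= s a b <= b;
  mean_homogeneous : forall c a b, 0 < c -> 0 <= a -> 0 <= b ->
    s (c * a) (c * b) = c * s a b
}.

Definition symmetric_mean (R : realType) (s : R -> R -> R) : Prop :=
  is_mean s /\ forall a b, 0 <= a -> 0 <= b -> s a b = s b a.

Record interpolation_path (R : realType) (s : R -> R -> R)
    (path : R -> R -> R -> R) : Prop := InterpolationPath {
  path_mean : forall mu, 0 <= mu <= 1 -> is_mean (path mu);
  path0 : forall a b, 0 <= a -> 0 <= b -> path 0 a b = b;
  path1 : forall a b, 0 <= a -> 0 <= b -> path 1 a b = a;
  path_half : forall a b, 0 <= a -> 0 <= b -> path (2^-1) a b = s a b;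
  path_mid : forall mu nu a b, 0 <= mu <= 1 -> 0 <= nu <= 1 ->
    0 <= a -> 0 <= b ->
    s (path mu a b) (path nu a b) = path ((mu + nu) / 2) a b
}.

(* Norms and moduli take values in R[i]; their real part is the underlying
   element of R. *)
Definition berezin_norm (R : realType) (Omega : Type) (H : rkhs R Omega)
    (s : R -> R -> R) (p : R) (T : {linear H -> H}) : R :=
  sup [set (s (complex.Re `|dot (T (rk_nkernel H lam)) (rk_nkernel H lam)| `^ p)
              (complex.Re `|T (rk_nkernel H lam)| `^ p)) `^ p^-1
      | lam in [set: Omega]].

(* Main.v *)
Require Import Defs.
From HB Require Import structures.
From mathcomp Require Import all_boot all_order all_algebra.
From mathcomp Require Import all_classical all_reals all_analysis.
From mathcomp Require Import complex ring lra.

Set Implicit Arguments.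
Unset Strict Implicit.
Unset Printing Implicit Defensive.

Import Order.TTheory GRing.Theory Num.Theory.
Import numFieldNormedType.Exports.

Local Open Scope classical_set_scope.
Local Open Scope ring_scope.

(* For a unit vector k, |<Tk,k>| = |<k,T*k>| is at most both |Tk| and |T*k|, so
   |<Tk,k>|^2 <= (|Tk|^2 + |T*k|^2) / 2 = <(|T|^2 + |T*|^2) k, k> / 2, while
   |Tk|^2 = <|T|^2 k, k>; monotonicity of the mean then compares the two suprema
   pointwise.  The identities |T|^2 = T*T and |T*|^2 = TT* need T* and the square
   root of T*T to exist.  The adjoint comes from Riesz representation.  For the
   root, if |T| <= M then B = 1 - M^-2 T*T is a self-adjoint contraction, and
   Y |-> (B + Y^2) / 2, iterated from 0, converges in norm, being dominated by
   the scalar iteration t |-> (1 + t^2) / 2, which increases to 1; its limit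
   satisfies (1 - Y)^2 = 1 - B. *)

(** * The real inner product Re<x, y>, Cauchy-Schwarz and completeness *)

Section RealInnerProduct.
Variables (R : realType) (Omega : Type) (H : rkhs R Omega).
Implicit Types (x y z : H) (a e : R).

Local Notation Re := complex.Re.

Definition rdot x y : R := Re (dot x y).
Definition rnorm x : R := Re `|x|.

Lemma ReD (u v : R[i]) : Re (u + v) = Re u + Re v.
Proof. by case: u; case: v. Qed.

Lemma ReN (u : R[i]) : Re (- u) = - Re u.
Proof. by case: u. Qed.

Lemma Re_realM a (u : R[i]) : Re (a%:C%C * u) = a * Re u.
Proof. by case: u => b c /=; rewrite mul0r subr0. Qed.

Lemma rdotC x y : rdot x y = rdot y x.
Proof.
by rewrite /rdot /dot hermC /= expr0 mul1r; case: (rk_dot _ y x) => a b.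
Qed.

Lemma rdotDl x y z : rdot (x + y) z = rdot x z + rdot y z.
Proof. by rewrite /rdot /dot linearDl ReD. Qed.

Lemma rdotDr x y z : rdot z (x + y) = rdot z x + rdot z y.
Proof. by rewrite rdotC rdotDl !(rdotC z). Qed.

Lemma rdotNl x z : rdot (- x) z = - rdot x z.
Proof. by rewrite /rdot /dot linearNl ReN. Qed.

Lemma rdotNr x z : rdot z (- x) = - rdot z x.
Proof. by rewrite rdotC rdotNl rdotC. Qed.

Lemma rdotZl a x z : rdot (a%:C%C *: x) z = a * rdot x z.
Proof. by rewrite /rdot /dot linearZl_LR /= Re_realM. Qed.

Lemma rdotZr a x z : rdot z (a%:C%C *: x) = a * rdot z x.
Proof. by rewrite rdotC rdotZl rdotC. Qed.

Definition rdotE := (rdotDl, rdotDr, rdotNl, rdotNr, rdotZl, rdotZr).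

Lemma normE x : `|x| = (rnorm x)%:C%C.
Proof. by rewrite /rnorm RRe_real // ger0_real. Qed.

Lemma rnorm_ge0 x : 0 <= rnorm x.
Proof. by rewrite -ler0c -normE. Qed.

Lemma rnormZ (c : R[i]) x : rnorm (c *: x) = Re `|c| * rnorm x.
Proof. by rewrite /rnorm normrZ normc_def Re_realM. Qed.

Lemma rnormZr a x : 0 <= a -> rnorm (a%:C%C *: x) = a * rnorm x.
Proof. by move=> a0; rewrite rnormZ ger0_norm ?ler0c. Qed.

Lemma rnormD x y : rnorm (x + y) <= rnorm x + rnorm y.
Proof.
by have := ler_normD x y; rewrite !normE -rmorphD lecR.
Qed.

Lemma rnormN x : rnorm (- x) = rnorm x.
Proof. by rewrite /rnorm normrN. Qed.

Lemma rnormB x y : rnorm (x - y) = rnorm (y - x).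
Proof. by rewrite -rnormN opprB. Qed.

Lemma rnorm0 : rnorm 0 = 0.
Proof. by rewrite /rnorm normr0. Qed.

Lemma rnorm_eq0 x : rnorm x = 0 -> x = 0.
Proof. by move=> x0; apply/normr0_eq0; rewrite normE x0. Qed.

Lemma dotxx x : dot x x = (rnorm x ^+ 2)%:C%C.
Proof. by rewrite /dot -rk_normE normE rmorphXn. Qed.

Lemma rdotxx x : rdot x x = rnorm x ^+ 2.
Proof. by rewrite /rdot dotxx. Qed.

(** The triangle inequality is part of the normed structure; squaring it and expanding both sides
    leaves Cauchy-Schwarz. *)
Lemma rdot_le x y : rdot x y <= rnorm x * rnorm y.
Proof.
have : rnorm (x + y) ^+ 2 <= (rnorm x + rnorm y) ^+ 2.
  by rewrite lerXn2r ?nnegrE ?addr_ge0 ?rnorm_ge0 ?rnormD.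
rewrite -rdotxx !rdotE !rdotxx (rdotC y x); lra.
Qed.

Lemma normr_rdot_le x y : `|rdot x y| <= rnorm x * rnorm y.
Proof.
by rewrite ler_norml rdot_le andbT lerNl -rdotNl -(rnormN x) rdot_le.
Qed.

Lemma norm_dot_le x y : Re `|dot x y| <= rnorm x * rnorm y.
Proof.
have [->|d0] := eqVneq (dot x y) 0.
  by rewrite normr0 mulr_ge0 ?rnorm_ge0.
have n0 : `|dot x y| != 0 by rewrite normr_eq0.
(* A unimodular factor rotates [dot x y] onto its modulus, which reduces the claim to the real
   form. *)
pose c := `|dot x y| / dot x y.
have c1 : `|c| = 1 by rewrite normrM normr_id normfV divff.
have -> : Re `|dot x y| = rdot (c *: x) y.
  by rewrite /rdot /dot linearZl_LR /= /c -/(dot x y) divfK.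
by rewrite (le_trans (rdot_le _ _)) // rnormZ c1 mul1r.
Qed.

(* The real part of the form determines the form, since [Im z = Re (- 'i z)]. *)
Lemma dot_rdot x y : dot x y = (rdot x y +i* rdot (- 'i%C *: x) y)%C.
Proof.
have -> : rdot (- 'i%C *: x) y = Re (- 'i%C * dot x y).
  by rewrite /rdot /dot linearZl_LR.
rewrite /rdot; by case: (dot x y) => a b /=; congr (_ +i* _)%C; ring.
Qed.

Lemma rdot_inj x y : (forall z, rdot z x = rdot z y) -> x = y.
Proof.
move=> xy; apply/eqP; rewrite -subr_eq0; apply/eqP/rnorm_eq0/eqP.
by rewrite -sqrf_eq0 -rdotxx rdotDr rdotNr xy subrr.
Qed.

Definition rcvg (u : nat -> H) (l : H) : Prop :=
  forall e, 0 < e -> exists N, forall n, (N <= n)%N -> rnorm (u n - l) <= e.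

Lemma rnorm_complete (u : nat -> H) :
  (forall e, 0 < e -> exists N, forall m n, (N <= m)%N -> (N <= n)%N ->
     rnorm (u m - u n) <= e) ->
  exists l, rcvg u l.
Proof.
move=> ucauchy.
(* Radii of balls live in [R[i]]; a positive one is real, so real radii suffice. *)
have posC (e : R[i]) : 0 < e -> 0 < Re e /\ e = (Re e)%:C%C.
  by case: e => a b; rewrite ltcE /= => /andP[/eqP -> a0].
have /cauchy_cvg /cvg_ex[l ul] : cauchy (u @ \oo).
  apply/cauchy_exP => e /posC[e0 ->].
  have [|N uN] := ucauchy (Re e / 2); first by lra.
  exists (u N); exists N => //= n Nn.
  rewrite -ball_normE /= normE ltcR.
  by have := uN _ _ (leqnn N) Nn; lra.
exists l => e e0.
move/cvgrPdist_lt: ul => /(_ e%:C%C)[|N _ uN]; first by rewrite ltcR.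
by exists N => n Nn; have := uN n Nn; rewrite normE ltcR rnormB => /ltW.
Qed.

Lemma bounded_mapP (f : H -> H) :
  bounded_map f <-> exists2 M : R, 0 < M & forall x, rnorm (f x) <= M * rnorm x.
Proof.
split=> [[M fM]|[M M0 fM]]; last first.
  by exists M%:C%C => x; rewrite !normE -rmorphM lecR.
(* Adding 1 makes the constant strictly positive, so that it can be inverted later. *)
exists (`|Re M| + 1) => [|x]; first by rewrite ltr_wpDl.
have : rnorm (f x) <= Re M * rnorm x.
  have := fM x; rewrite !normE lecE => /andP[_] /=.
  by case: M {fM} => a b /=; rewrite mulr0 subr0.
move=> /le_trans; apply; rewrite ler_wpM2r ?rnorm_ge0 //.
by have := ler_norm (Re M); lra.
Qed.

End RealInnerProduct.

(** * Riesz representation and existence of the adjoint *)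

Section Adjoint.
Variables (R : realType) (Omega : Type) (H : rkhs R Omega).
Implicit Types (x y z : H) (a e : R).

Local Notation Re := complex.Re.

(* The functional is represented by the minimizer of [|x|^2 - 2 f x]; a
   minimizing sequence is Cauchy by the parallelogram identity. *)
Lemma riesz (f : H -> R) (M : R) :
  (forall x y, f (x + y) = f x + f y) ->
  (forall a x, f (a%:C%C *: x) = a * f x) ->
  (forall x, `|f x| <= M * rnorm x) ->
  exists k, forall x, f x = rdot x k.
Proof.
move=> fD fZ fM.
pose J x := rnorm x ^+ 2 - 2 * f x.
(* Completing the square: |x|^2 - 2 M |x| >= - M^2. *)
have J_lb x : - M ^+ 2 <= J x.
  have := fM x; rewrite ler_norml => /andP[_ fx].
  by have := sqr_ge0 (rnorm x - M); rewrite /J; nra.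
have infJ : has_inf (range J).
  by split; [exists (J 0), 0|exists (- M ^+ 2) => _ [x _ <-]].
pose m := inf (range J).
have mJ x : m <= J x by apply: (ge_inf infJ.2); exists x.
have /choice[u uJ] : forall n : nat, exists x, J x < m + n.+1%:R^-1.
  move=> n; have [|_ [x _ <-] Jx] := @inf_adherent _ _ n.+1%:R^-1 _ infJ.
    by rewrite invr_gt0.
  by exists x.
have inv_small e : 0 < e -> exists N, forall n, (N <= n)%N -> n.+1%:R^-1 <= e.
  move=> e0; exists (Num.truncn e^-1) => n Nn.
  rewrite -[e]invrK lef_pV2 ?posrE ?invr_gt0 //.
  by rewrite (le_trans (ltW (truncnS_gt _))) // ler_nat.
have Jpar x y : rnorm (x - y) ^+ 2 = 2 * J x + 2 * J y
    - 4 * J (2^-1%:C%C *: (x + y)).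
  rewrite /J fZ fD -!rdotxx !rdotE (rdotC y x).
  by field.
have [k uk] : exists k, rcvg u k.
  apply: rnorm_complete => e e0.
  (* If two values of [J] are within e^2/4 of [m], then, the value at the midpoint being at least
     [m], [Jpar] bounds the squared distance by e^2. *)
  have [|N Ne] := inv_small (e ^+ 2 / 4); first by rewrite divr_gt0 ?exprn_gt0.
  exists N => i j Ni Nj.
  rewrite -(ler_pXn2r (n := 2)) ?nnegrE ?rnorm_ge0 ?(ltW e0) //.
  rewrite Jpar; have := mJ (2^-1%:C%C *: (u i + u j)).
  move: (uJ i) (uJ j) (Ne _ Ni) (Ne _ Nj).
  by move: (i.+1%:R^-1) (j.+1%:R^-1) => di dj; lra.
(* The expression is J (k + v) - J k. Minimality of [k] is obtained along [u n]: half of [e] pays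
   for replacing [u n] by [k] in the inner product, the other half for J (u n) exceeding [m]. *)
have k_min v : 0 <= 2 * (rdot k v - f v) + rnorm v ^+ 2.
  have v1 : 0 < 2 * rnorm v + 1 by have := rnorm_ge0 v; lra.
  apply/ler_addgt0Pr => e e0.
  have [|N1 uN1] := uk (e / 2 / (2 * rnorm v + 1)).
    by rewrite !divr_gt0.
  have [|N2 uN2] := inv_small (e / 2); first by lra.
  pose n := maxn N1 N2.
  have /uN1 un1 : (N1 <= n)%N by rewrite leq_maxl.
  have /uN2 un2 : (N2 <= n)%N by rewrite leq_maxr.
  have uv : J (u n + v) = J (u n) + 2 * rdot (u n) v + rnorm v ^+ 2 - 2 * f v.
    by rewrite /J fD -!rdotxx !rdotE (rdotC v); ring.
  have := mJ (u n + v); rewrite uv => Jn.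
  have dv : 2 * rdot (u n - k) v <= e / 2.
    move: un1 (rdot_le (u n - k) v) (rnorm_ge0 (u n - k)).
    rewrite ler_pdivlMr //; lra.
  move: dv (uJ n) un2; rewrite rdotDl rdotNl.
  by move: (n.+1%:R^-1) => d; lra.
exists k => v.
pose q := rnorm v ^+ 2; pose c := rdot k v - f v.
have q1 : 0 < q + 1 by rewrite ltr_wpDl ?exprn_ge0 ?rnorm_ge0.
(* This multiple of [v] turns the bound of [k_min] into a nonpositive multiple of [c ^+ 2], which
   forces c = 0; the denominator [q + 1] is nonzero even for v = 0. *)
have := k_min ((- c / (q + 1))%:C%C *: v).
rewrite -rdotxx rdotZr fZ !rdotE rdotxx -/q.
have -> : 2 * (- c / (q + 1) * rdot k v - - c / (q + 1) * f v) +
  - c / (q + 1) * (- c / (q + 1) * q) = - (c ^+ 2 * (q + 2) / (q + 1) ^+ 2).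
  by rewrite /c; field; rewrite gt_eqF.
rewrite oppr_ge0 pmulr_lle0 ?invr_gt0 ?exprn_gt0 // pmulr_lle0; last by lra.
rewrite le_eqVlt ltNge sqr_ge0 orbF sqrf_eq0 => /eqP c0.
by rewrite rdotC; move: c0; rewrite /c; lra.
Qed.

(** Maps obtained by choice carry no linear structure; this bundles them once linearity is
    proved. *)
Lemma pack_linear (f : H -> H) : linear f ->
  exists g : {linear H -> H}, forall x, g x = f x.
Proof.
move=> lf; pose fL := GRing.isLinear.Build R[i] H H *:%R f lf.
by exists (HB.pack_for {linear H -> H} f fL).
Qed.

Lemma rdotZ_conj (c : R[i]) x y : rdot x (c *: y) = rdot (c^* *: x) y.
Proof. by rewrite /rdot /dot linearZl_LR linearZr_LR. Qed.

(** The imaginary part of the form is its real part with the first argument multiplied by -i, and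
    [T] commutes with that scalar. *)
Lemma rdot_adjoint_dot (T S : {linear H -> H}) :
  (forall x y, rdot (T x) y = rdot x (S y)) ->
  forall x y, dot (T x) y = dot x (S y).
Proof.
by move=> TS x y; rewrite !dot_rdot -!TS linearZ.
Qed.

(** |S y|^2 = Re<T (S y), y> <= M |S y| |y|; dividing by |S y| requires it to be nonzero. *)
Lemma adjoint_bound (T S : H -> H) (M : R) : 0 <= M ->
  (forall x, rnorm (T x) <= M * rnorm x) ->
  (forall x y, rdot (T x) y = rdot x (S y)) ->
  forall y, rnorm (S y) <= M * rnorm y.
Proof.
move=> M0 TM TS y; have [S0|S0] := eqVneq (rnorm (S y)) 0.
  by rewrite S0 mulr_ge0 ?rnorm_ge0.
have Sy : 0 < rnorm (S y) by rewrite lt_def S0 rnorm_ge0.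
rewrite -(ler_pM2l Sy) -expr2 -rdotxx -TS.
apply: le_trans (rdot_le _ _) _.
by rewrite mulrA (mulrC _ M) ler_wpM2r ?rnorm_ge0.
Qed.

Lemma adjointP (T : {linear H -> H}) : bounded_map T ->
  is_adjoint T (adjoint T).
Proof.
move=> /bounded_mapP[M M0 TM].
(* [xget] returns a member of the set as soon as there is one, so existence is enough. *)
suff [S TS] : exists S : {linear H -> H}, is_adjoint T S.
  by rewrite /adjoint; case: xgetP => [_ ->|/(_ S)].
have /choice[S0 TS0] : forall y, exists k, forall x, rdot (T x) y = rdot x k.
  move=> y; apply: (@riesz _ (M * rnorm y)) => [x z|a x|x].
  - by rewrite linearD rdotDl.
  - by rewrite linearZ rdotZl.
  - rewrite (le_trans (normr_rdot_le _ _)) // mulrAC ler_wpM2r ?rnorm_ge0 //.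
have [|S SS0] := @pack_linear S0.
  (* Representers are unique, so linearity can be tested against every [x]; the complex scalar
     crosses the form as its conjugate. *)
  move=> c y y'; apply: rdot_inj => x.
  by rewrite -TS0 !rdotDr !rdotZ_conj -!TS0 linearZ.
have TS x y : rdot (T x) y = rdot x (S y) by rewrite SS0 TS0.
exists S; split; last exact: rdot_adjoint_dot.
by apply/bounded_mapP; exists M => //; apply: adjoint_bound TM TS; apply: ltW.
Qed.

Lemma adjoint_dot (T : {linear H -> H}) : bounded_map T ->
  forall x y, dot (T x) y = dot x (adjoint T y).
Proof. by move=> /adjointP[]. Qed.

Lemma dotC x y : dot x y = (dot y x)^*.
Proof. by rewrite /dot hermC /= expr0 mul1r. Qed.

End Adjoint.

(** * Existence of the square root of T*T *)

Section SquareRoot.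
Variables (R : realType) (Omega : Type) (H : rkhs R Omega).
Implicit Types (x y z : H) (a e : R).

Local Notation Re := complex.Re.

(* [1 - sqrt_gap n] is the n-th iterate from 0 of [t |-> (1 + t ^ 2) / 2], the
   scalar majorant of the operator iteration [Y |-> (B + Y ^ 2) / 2]. *)
Fixpoint sqrt_gap (n : nat) : R :=
  if n is m.+1 then sqrt_gap m - sqrt_gap m ^+ 2 / 2 else 1.

(** The map t |-> t - t^2/2 is increasing on [0, 1] and sends 2/(n+2) below 2/(n+3), the difference
    being 2/((n+3)(n+2)^2). *)
Lemma sqrt_gap_bounds n : 0 <= sqrt_gap n <= 2 / n.+2%:R.
Proof.
elim: n => [|n /andP[e0 en]] /=; first by rewrite divff ?ler01 ?lexx.
have n0 : 0 <= n%:R :> R by [].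
have n2 : 2 / n.+2%:R <= 1 :> R.
  by rewrite ler_pdivrMr // mul1r ler_nat.
have [eS_ge0 eS_le] : 0 <= sqrt_gap n - sqrt_gap n ^+ 2 / 2 /\
    sqrt_gap n - sqrt_gap n ^+ 2 / 2 <= 2 / n.+2%:R - (2 / n.+2%:R) ^+ 2 / 2.
  by move: (sqrt_gap n) (2 / _) e0 en n2 => t b; split; nra.
rewrite eS_ge0 /=; apply: le_trans eS_le _.
rewrite -subr_ge0.
suff -> : 2 / n.+3%:R - (2 / n.+2%:R - (2 / n.+2%:R) ^+ 2 / 2) =
  2 / (n.+3%:R * n.+2%:R ^+ 2) :> R by rewrite divr_ge0 ?mulr_ge0 ?exprn_ge0.
by rewrite -!natr1; field; rewrite !natr1 !pnatr_eq0.
Qed.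

Lemma sqrt_gap_ge0 n : 0 <= sqrt_gap n.
Proof. by have /andP[] := sqrt_gap_bounds n. Qed.

Lemma sqrt_gapS_le n : sqrt_gap n.+1 <= sqrt_gap n.
Proof. by rewrite /= gerBl divr_ge0 ?exprn_ge0 ?sqrt_gap_ge0. Qed.

Lemma sqrt_gap_le1 n : sqrt_gap n <= 1.
Proof. by elim: n => // n IH; apply: le_trans (sqrt_gapS_le n) IH. Qed.

Lemma sqrt_gap_small e : 0 < e ->
  exists N, forall n, (N <= n)%N -> sqrt_gap n <= e.
Proof.
move=> e0; exists (Num.truncn (2 / e)) => n Nn.
have /andP[_ /le_trans] := sqrt_gap_bounds n; apply.
rewrite ler_pdivrMr // mulrC -ler_pdivrMr //.
rewrite (le_trans (ltW (truncnS_gt _))) // ler_nat.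
by rewrite (leq_trans (n := n.+1)).
Qed.

(** Since [sqrt_gap] tends to 0, an estimate valid for every [n] replaces a passage to the limit. *)
Lemma le0_sqrt_gap a (C : R) : 0 <= C -> (forall n, a <= sqrt_gap n * C) ->
  a <= 0.
Proof.
move=> C0 aC; apply/ler_addgt0Pr => e e0; rewrite add0r.
have C1 : 0 < C + 1 by rewrite ltr_wpDl.
have [|N gN] := @sqrt_gap_small (e / (C + 1)); first by rewrite divr_gt0.
have := gN _ (leqnn N); rewrite ler_pdivlMr // => gC.
have := aC N; have := sqrt_gap_ge0 N; lra.
Qed.

Lemma eq_sqrt_gap x y (C : R) : 0 <= C ->
  (forall n, rnorm (x - y) <= sqrt_gap n * C) -> x = y.
Proof.
move=> C0 xyC; apply/eqP; rewrite -subr_eq0; apply/eqP/rnorm_eq0.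
by apply/eqP; rewrite eq_le rnorm_ge0 (le0_sqrt_gap C0 xyC).
Qed.

(** * The operator iteration for a self-adjoint contraction, and its fixed point *)

Section Iteration.
Variable B : {linear H -> H}.
Hypothesis B_contr : forall x, rnorm (B x) <= rnorm x.
Hypothesis B_sym : forall x y, rdot (B x) y = rdot x (B y).

Fixpoint sqrt_iter (n : nat) : {linear H -> H} :=
  if n is m.+1
  then (2^-1%:C%C : R[i]) \*: (B \+ (sqrt_iter m \o sqrt_iter m)) else \0.

Lemma sqrt_iterS n x :
  sqrt_iter n.+1 x = 2^-1%:C%C *: (B x + sqrt_iter n (sqrt_iter n x)).
Proof. by []. Qed.

Lemma sqrt_iter_sym n x y :
  rdot (sqrt_iter n x) y = rdot x (sqrt_iter n y).
Proof.
elim: n x y => [|n IH] x y.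
  by rewrite /= -[0]/(0 : H) -(scale0r 0) !rdotE !mul0r.
by rewrite !sqrt_iterS !rdotE B_sym !IH.
Qed.

(** With g = [sqrt_gap n], the induction step is (1 + (1 - g)^2)/2 = 1 - (g - g^2/2). *)
Lemma sqrt_iter_le n x : rnorm (sqrt_iter n x) <= (1 - sqrt_gap n) * rnorm x.
Proof.
elim: n x => [|n IH] x; first by rewrite /= rnorm0 subrr mul0r.
rewrite sqrt_iterS rnormZr //.
have := rnormD (B x) (sqrt_iter n (sqrt_iter n x)).
have := B_contr x; have := IH x; have := IH (sqrt_iter n x).
have := sqrt_gap_le1 n; have := rnorm_ge0 x; rewrite /=; nra.
Qed.

Lemma sqrt_iter_contr n x : rnorm (sqrt_iter n x) <= rnorm x.
Proof.
apply: le_trans (sqrt_iter_le n x) _.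
by rewrite ler_piMl ?rnorm_ge0 // gerBl sqrt_gap_ge0.
Qed.

(** Writing Y, Y' for consecutive iterates, Y'^2 - Y^2 = Y'(Y' - Y) + (Y' - Y)Y without any
    commutation. The scalar increments satisfy the same identity exactly, hence dominate. *)
Lemma sqrt_iter_step n x : rnorm (sqrt_iter n.+1 x - sqrt_iter n x) <=
  (sqrt_gap n - sqrt_gap n.+1) * rnorm x.
Proof.
elim: n x => [|n IH] x.
  rewrite sqrt_iterS /= addr0 subr0 rnormZr //.
  by have := B_contr x; lra.
have -> : sqrt_iter n.+2 x - sqrt_iter n.+1 x = 2^-1%:C%C *:
    (sqrt_iter n.+1 (sqrt_iter n.+1 x - sqrt_iter n x) +
     (sqrt_iter n.+1 (sqrt_iter n x) - sqrt_iter n (sqrt_iter n x))).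
  rewrite linearB addrA subrK (sqrt_iterS n.+1) [X in _ - X = _](sqrt_iterS n).
  by rewrite -scalerBr opprD addrACA subrr add0r.
rewrite rnormZr //.
set u := sqrt_iter n.+1 (_ - _); set v := sqrt_iter n.+1 _ - _.
have uv := rnormD u v.
have := sqrt_iter_le n.+1 (sqrt_iter n.+1 x - sqrt_iter n x); rewrite -/u => ub.
have := IH (sqrt_iter n x); rewrite -/v => vb.
have nb := sqrt_iter_le n x; have xb := IH x.
have := sqrt_gapS_le n; have := sqrt_gap_le1 n.+1; have := sqrt_gap_le1 n.
have := rnorm_ge0 x.
have -> : sqrt_gap n.+2 = sqrt_gap n.+1 - sqrt_gap n.+1 ^+ 2 / 2 by [].
have sE : sqrt_gap n.+1 = sqrt_gap n - sqrt_gap n ^+ 2 / 2 by [].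
move: (sqrt_gap n.+1) (sqrt_gap n) sE ub vb nb xb => t s sE ub vb nb xb x0 s1 t1 ts.
have {}ub : rnorm u <= (1 - t) * ((s - t) * rnorm x).
  by apply: le_trans ub _; rewrite ler_wpM2l // subr_ge0.
have {}vb : rnorm v <= (s - t) * ((1 - s) * rnorm x).
  by apply: le_trans vb _; rewrite ler_wpM2l // subr_ge0.
have -> : t - (t - t ^+ 2 / 2) = 2^-1 * ((1 - t) * (s - t) + (s - t) * (1 - s)).
  by move: sE; lra.
rewrite -mulrA ler_wpM2l ?invr_ge0 // mulrDl -!mulrA; lra.
Qed.

Lemma sqrt_iter_dist n k x : rnorm (sqrt_iter (n + k) x - sqrt_iter n x) <=
  (sqrt_gap n - sqrt_gap (n + k)) * rnorm x.
Proof.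
elim: k => [|k IH]; first by rewrite addn0 !subrr rnorm0 mul0r.
rewrite addnS.
have := rnormD (sqrt_iter (n + k).+1 x - sqrt_iter (n + k) x)
  (sqrt_iter (n + k) x - sqrt_iter n x).
rewrite addrA subrK => /le_trans; apply.
by have := sqrt_iter_step (n + k) x; lra.
Qed.

(** The rate of convergence is kept with the limit: symmetry, linearity and the fixed-point equation
    will all be derived from it. *)
Lemma sqrt_iter_lim : exists Y : H -> H, forall n x,
  rnorm (Y x - sqrt_iter n x) <= sqrt_gap n * rnorm x.
Proof.
have dist m n x : (n <= m)%N ->
    rnorm (sqrt_iter m x - sqrt_iter n x) <= sqrt_gap n * rnorm x.
  move=> /subnKC <-; apply: le_trans (sqrt_iter_dist n (m - n) x) _.
  by rewrite ler_wpM2r ?rnorm_ge0 // gerBl sqrt_gap_ge0.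
have /choice[Y YP] : forall x, exists l, rcvg (fun n => sqrt_iter n x) l.
  move=> x; apply: rnorm_complete => e e0.
  have x1 : 0 < rnorm x + 1 by rewrite ltr_wpDl ?rnorm_ge0.
  have [|N gN] := @sqrt_gap_small (e / (rnorm x + 1)); first by rewrite divr_gt0.
  have key n : (N <= n)%N -> sqrt_gap n * rnorm x <= e.
    move=> /gN; rewrite ler_pdivlMr //.
    by have := sqrt_gap_ge0 n; lra.
  exists N => m n Nm Nn; have [nm|/ltnW mn] := leqP n m.
    exact: le_trans (dist _ _ x nm) (key _ Nn).
  by rewrite rnormB; apply: le_trans (dist _ _ x mn) (key _ Nm).
exists Y => n x; apply/ler_addgt0Pr => e e0.
have [N YN] := YP x e e0.
have := rnormD (Y x - sqrt_iter (maxn N n) x)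
  (sqrt_iter (maxn N n) x - sqrt_iter n x).
rewrite addrA subrK => /le_trans; apply.
have := dist _ _ x (leq_maxr N n); have := YN _ (leq_maxl N n).
by rewrite rnormB; lra.
Qed.

Lemma sqrt_iter_fixpoint : exists Y : {linear H -> H}, [/\
  forall x, rnorm (Y x) <= rnorm x,
  forall x y, rdot (Y x) y = rdot x (Y y) &
  forall x, Y x = 2^-1%:C%C *: (B x + Y (Y x))].
Proof.
have [Y YP] := sqrt_iter_lim.
(* At index 0 the iterate is 0 and the gap is 1. *)
have Ycontr x : rnorm (Y x) <= rnorm x.
  by have := YP 0 x; rewrite /= subr0 mul1r.
have Ysym x y : rdot (Y x) y = rdot x (Y y).
  apply/eqP; rewrite -subr_eq0 -normr_eq0 eq_le normr_ge0 andbT.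
  apply: (@le0_sqrt_gap _ (2 * rnorm x * rnorm y)) => [|n].
    by rewrite !mulr_ge0 ?rnorm_ge0.
  have -> : rdot (Y x) y - rdot x (Y y) =
      rdot (Y x - sqrt_iter n x) y - rdot x (Y y - sqrt_iter n y).
    by rewrite !rdotE sqrt_iter_sym; ring.
  apply: le_trans (ler_normB _ _) _.
  have := normr_rdot_le (Y x - sqrt_iter n x) y.
  have := normr_rdot_le x (Y y - sqrt_iter n y).
  have := YP n x; have := YP n y; have := rnorm_ge0 x; have := rnorm_ge0 y.
  nra.
have [|Y' Y'E] := @pack_linear _ _ H Y.
  move=> c x y; apply: (@eq_sqrt_gap _ _
    (rnorm (c *: x + y) + (Re `|c| * rnorm x + rnorm y))) => [|n].
    by rewrite !addr_ge0 ?mulr_ge0 ?rnorm_ge0 // -ler0c RRe_real // ger0_real.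
  (* The iterates are linear, so [Y] and its error [D] have the same linearity defect. *)
  pose D z := Y z - sqrt_iter n z.
  have -> : Y (c *: x + y) - (c *: Y x + Y y) =
      D (c *: x + y) - (c *: D x + D y).
    rewrite /D linearP scalerBr addrACA -opprD opprB addrA subrK.
    by [].
  apply: le_trans (rnormD _ _) _; rewrite rnormN mulrDr lerD ?YP //.
  apply: le_trans (rnormD _ _) _; rewrite rnormZ mulrDr lerD ?YP //.
  rewrite mulrCA ler_wpM2l ?YP // -ler0c RRe_real // ger0_real //.
exists Y'; split=> [x|x y|x]; rewrite ?Y'E //.
apply: (@eq_sqrt_gap _ _ (2 * rnorm x)) => [|n].
  by rewrite mulr_ge0 ?rnorm_ge0.
(* The first error costs at most [sqrt_gap n * rnorm x], and so does the half-sum of the other two,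
   since [sqrt_iter n] and [Y] are contractions; hence the constant 2. *)
have -> : Y x - 2^-1%:C%C *: (B x + Y (Y x)) =
    (Y x - sqrt_iter n.+1 x) + 2^-1%:C%C *:
      (sqrt_iter n (sqrt_iter n x - Y x) + (sqrt_iter n (Y x) - Y (Y x))).
  rewrite linearB addrA subrK sqrt_iterS -[RHS]addrA; congr (_ + _).
  by rewrite scalerBr !scalerDr !opprD addrA subrK.
have := rnormD (Y x - sqrt_iter n.+1 x) (2^-1%:C%C *:
  (sqrt_iter n (sqrt_iter n x - Y x) + (sqrt_iter n (Y x) - Y (Y x)))).
move=> /le_trans; apply; rewrite rnormZr //.
have := rnormD (sqrt_iter n (sqrt_iter n x - Y x)) (sqrt_iter n (Y x) - Y (Y x)).
have := sqrt_iter_contr n (sqrt_iter n x - Y x); have := YP n x.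
rewrite (rnormB (Y x)) (rnormB _ (Y (Y x))).
have := YP n.+1 x; have := YP n (Y x).
have := ler_wpM2l (sqrt_gap_ge0 n) (Ycontr x).
have := ler_wpM2r (rnorm_ge0 x) (sqrt_gapS_le n); lra.
Qed.

End Iteration.

Lemma sqrt_opP (T : {linear H -> H}) : bounded_map T ->
  forall x, sq_op (abs_op T) x = adjoint T (T x).
Proof.
move=> bT; have [bS TS] := adjointP bT.
suff [S Sprop] : exists S : {linear H -> H},
    positive_op S /\ forall x, S (S x) = (adjoint T \o T) x.
  rewrite /sq_op /abs_op /sqrt_op; case: xgetP => [_ -> [_ SS] x|/(_ S)//].
  exact: SS.
have /bounded_mapP[M M0 TM] := bT.
have rTS x y : rdot (T x) y = rdot x (adjoint T y) by rewrite /rdot TS.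
have SM := adjoint_bound (ltW M0) TM rTS.
pose B : {linear H -> H} := idfun \- ((M ^- 2)%:C%C : R[i]) \*: (adjoint T \o T).
have BE x : B x = x - (M ^- 2)%:C%C *: adjoint T (T x) by [].
have rST x y : rdot (adjoint T x) y = rdot x (T y).
  by rewrite rdotC -rTS rdotC.
have [||Y [Ycontr Ysym YE]] := @sqrt_iter_fixpoint B.
- move=> x; rewrite -(ler_pXn2r (n := 2)) ?nnegrE ?rnorm_ge0 //.
  rewrite -!rdotxx BE !rdotE (rdotC x) rST !rdotxx.
  set t := rnorm (T x); set s := rnorm (adjoint T (T x)).
  have st : s ^+ 2 <= (M * t) ^+ 2.
    by rewrite ler_pXn2r ?nnegrE ?rnorm_ge0 ?SM // mulr_ge0 ?rnorm_ge0 ?ltW.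
  have M2 : 0 < M ^+ 2 by rewrite exprn_gt0.
  have : (M ^- 2) ^+ 2 * s ^+ 2 <= M ^- 2 * t ^+ 2.
    rewrite expr2 -mulrA ler_pM2l ?invr_gt0 // ler_pdivrMl //.
    by rewrite -exprMn.
  have : 0 <= M ^- 2 * t ^+ 2.
    by rewrite mulr_ge0 ?invr_ge0 ?exprn_ge0 ?rnorm_ge0 ?ltW.
  by move: (M ^- 2) => c; lra.
- by move=> x y; rewrite !BE !rdotE rST -rTS.
pose S : {linear H -> H} := (M%:C%C : R[i]) \*: (idfun \- Y).
have SE x : S x = M%:C%C *: (x - Y x) by [].
have Ssym : forall x y, rdot (S x) y = rdot x (S y).
  by move=> x y; rewrite !SE !rdotE Ysym.
exists S; split=> [|x].
  split=> [|x].
    apply/bounded_mapP; exists (M * 2) => [|x]; first by rewrite mulr_gt0.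
    rewrite SE rnormZr ?(ltW M0) // -mulrA ler_pM2l //.
    have := rnormD x (- Y x); rewrite rnormN; have := Ycontr x; lra.
  (* Positivity in [R[i]] includes being real: by symmetry of [S] the value equals its own
     conjugate. The real part is nonnegative because [Y] is a contraction. *)
  have := dotC (S x) x; rewrite -(rdot_adjoint_dot Ssym).
  have : 0 <= rdot (S x) x.
    rewrite SE !rdotE rdotxx mulr_ge0 ?(ltW M0) //.
    have := rdot_le (Y x) x; have := Ycontr x; have := rnorm_ge0 x; nra.
  rewrite /rdot; case: (dot (S x) x) => a b /= a0 [b0].
  by rewrite lecE /= a0 andbT; apply/eqP; lra.
(* The fixed-point equation solved for Y^2; it gives (1 - Y)^2 = 1 - B, hence S^2 = M^2 (1 - B) =
   T*T. *)
have YY : Y (Y x) = Y x + Y x - B x.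
  have -> : Y x + Y x = B x + Y (Y x).
    rewrite -[RHS]scale1r -[1](rmorph1 (real_complex R)) [1]splitr rmorphD.
    by rewrite scalerDl mul1r -YE.
  by rewrite addrC addKr.
rewrite SE SE linearZ_LR (linearB Y) YY /= -scalerBr scalerA -rmorphM.
have -> : x - Y x - (Y x - (Y x + Y x - B x)) = x - B x.
  by rewrite !opprD !opprK !addrA !subrK.
rewrite BE opprB addrC subrK scalerA -rmorphM -expr2 divff ?scale1r //.
by rewrite expf_neq0 // gt_eqF.
Qed.

End SquareRoot.

(** * The quadratic forms of the inequality as norms *)

Section Berezin.
Variables (R : realType) (Omega : Type) (H : rkhs R Omega).
Local Notation Re := complex.Re.

Lemma rnorm_nkernel (lam : Omega) : rk_kernel H lam != 0 ->
  rnorm (rk_nkernel H lam) = 1.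
Proof.
by move=> k0; rewrite /rnorm normrZ normfV normr_id mulVf ?normr_eq0.
Qed.

Lemma rdot_sq_abs (T : {linear H -> H}) : bounded_map T ->
  forall x, rdot (sq_op (abs_op T) x) x = rnorm (T x) ^+ 2.
Proof.
by move=> bT x; rewrite sqrt_opP // rdotC /rdot -adjoint_dot // -rdotxx.
Qed.

(** Applying [rdot_sq_abs] to the adjoint itself avoids identifying the double adjoint with [T]. *)
Lemma rdot_sq_abs_adjoint (T : {linear H -> H}) : bounded_map T ->
  forall x, rdot (sq_op (abs_op (adjoint T)) x) x = rnorm (adjoint T x) ^+ 2.
Proof. by move=> bT; apply: rdot_sq_abs; case: (adjointP bT). Qed.

Lemma norm_dot_unit_le (T : {linear H -> H}) x : bounded_map T ->
  rnorm x = 1 ->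
  Re `|dot (T x) x| ^+ 2 <= 2^-1 * (rnorm (T x) ^+ 2 + rnorm (adjoint T x) ^+ 2).
Proof.
move=> bT x1.
have := norm_dot_le (T x) x; have := norm_dot_le x (adjoint T x).
rewrite -adjoint_dot // x1 mulr1 mul1r.
have : 0 <= Re `|dot (T x) x| by rewrite -ler0c RRe_real // ger0_real.
nra.
Qed.

End Berezin.

(** * An upper bound for means, and the comparison of the suprema *)

Lemma mean_le (R : realType) (s : R -> R -> R) (a b c : R) : is_mean s ->
  0 <= a <= c -> 0 <= b <= c -> s a b <= c.
Proof.
move=> ms /andP[a0 ac] /andP[b0 bc].
have c0 := le_trans a0 ac.
apply: le_trans (mean_monol ms a0 ac b0) _.
apply: le_trans (mean_monor ms c0 b0 bc) _.
(* Betweenness on the diagonal gives s c c = c. *)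
by have /andP[] := mean_between ms c0 (lexx c).
Qed.

Theorem theorem2p26 (R : realType) (Omega : Type)
    (Omega_nonempty : inhabited Omega)
    (H : rkhs R Omega)
    (kernel_neq0 : forall lam : Omega, rk_kernel H lam != 0)
    (T : {linear H -> H}) (T_bounded : bounded_map T)
    (sigma : R -> R -> R) (sigma_ : R -> R -> R -> R)
    (sigma_symmetric : symmetric_mean sigma) (sigma_path : interpolation_path sigma sigma_)
    (mu : R) (mu01 : 0 <= mu <= 1) (p : R) (p_ge1 : 1 <= p) :
  let absT2 := sq_op (abs_op T) in
  let absTs2 := sq_op (abs_op (adjoint T)) in
  berezin_norm (sigma_ mu) p T `^ p <=
  sup [set sigma_ mu
      (complex.Re (dot ((2^-1 : R[i]) *: (absT2 (rk_nkernel H lam)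
                                 + absTs2 (rk_nkernel H lam)))
                       (rk_nkernel H lam)) `^ (p / 2))
      (complex.Re (dot (absT2 (rk_nkernel H lam)) (rk_nkernel H lam)) `^ (p / 2))
    | lam in [set: Omega]].
Proof.
cbv zeta.
(* A point of [Omega] makes the sets of values nonempty, as the suprema require. *)
have [lam0] := Omega_nonempty.
have mean_mu := path_mean sigma_path mu01.
have p_gt0 : 0 < p by lra.
pose k lam := rk_nkernel H lam.
have k1 lam : rnorm (k lam) = 1 by apply: rnorm_nkernel.
have [M M0 TM] := (bounded_mapP T).1 T_bounded.
have TkM lam : rnorm (T (k lam)) <= M.
  by have := TM (k lam); rewrite k1 mulr1.
have TskM lam : rnorm (adjoint T (k lam)) <= M.
  have := adjoint_bound (ltW M0) TM _ (k lam); rewrite k1 mulr1; apply.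
  by move=> x y; rewrite /rdot adjoint_dot.
pose d lam := complex.Re `|dot (T (k lam)) (k lam)|.
have d_ge0 lam : 0 <= d lam by rewrite -ler0c RRe_real // ger0_real.
(* This is the value at [k lam] of the form of (|T|^2 + |T^*|^2)/2. *)
pose a lam := 2^-1 * (rnorm (T (k lam)) ^+ 2 + rnorm (adjoint T (k lam)) ^+ 2).
have a_ge0 lam : 0 <= a lam.
  by rewrite mulr_ge0 ?addr_ge0 ?exprn_ge0 ?rnorm_ge0.
have sq_powR (x : R) : 0 <= x -> (x ^+ 2) `^ (p / 2) = x `^ p.
  by move=> x0; rewrite -powR_mulrn // -powRrM; congr (_ `^ _); field.
pose rhs lam := sigma_ mu (a lam `^ (p / 2)) (rnorm (T (k lam)) `^ p).
pose lhs lam := sigma_ mu (d lam `^ p) (rnorm (T (k lam)) `^ p).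
have lhs_ge0 lam : 0 <= lhs lam by apply: mean_ge0; rewrite ?powR_ge0.
have lhs_rhs lam : lhs lam <= rhs lam.
  apply: mean_monol; rewrite ?powR_ge0 // -sq_powR //.
  apply: ge0_ler_powR; rewrite ?nnegrE ?divr_ge0 ?exprn_ge0 ?(ltW p_gt0) //.
  exact: norm_dot_unit_le.
have -> : [set sigma_ mu
    (complex.Re (dot ((2^-1 : R[i]) *: (sq_op (abs_op T) (k lam)
       + sq_op (abs_op (adjoint T)) (k lam))) (k lam)) `^ (p / 2))
    (complex.Re (dot (sq_op (abs_op T) (k lam)) (k lam)) `^ (p / 2))
    | lam in [set: Omega]] = range rhs.
  apply: eq_imagel => lam _ /=.
  rewrite -/(rdot _ (k lam)) -/(rdot (sq_op _ _) _).
  have -> : (2^-1 : R[i]) = 2^-1%:C%C by rewrite fmorphV rmorph_nat.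
  by rewrite !rdotE rdot_sq_abs // rdot_sq_abs_adjoint // sq_powR // rnorm_ge0.
(* The real [sup] of an unbounded set is a default 0, so a bound is needed before comparing; [M]
   bounds both |T k| and |T^* k|, whence [a lam] is at most M^2. *)
have rhs_ub : has_ubound (range rhs).
  exists (M `^ p) => _ [lam _ <-]; apply: (mean_le mean_mu).
    rewrite powR_ge0 /= -(sq_powR M) ?(ltW M0) //.
    apply: ge0_ler_powR;
      rewrite ?nnegrE ?divr_ge0 ?exprn_ge0 ?(ltW p_gt0) ?(ltW M0) //.
    have := TkM lam; have := TskM lam; rewrite /a.
    have := rnorm_ge0 (T (k lam)); have := rnorm_ge0 (adjoint T (k lam)); nra.
  rewrite powR_ge0 /=; apply: ge0_ler_powR; rewrite ?nnegrE ?rnorm_ge0 //;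
    exact: ltW.
have rhs_le lam : rhs lam <= sup (range rhs) by apply: ub_le_sup => //; exists lam.
have sup_ge0 : 0 <= sup (range rhs).
  exact: le_trans (lhs_ge0 lam0) (le_trans (lhs_rhs lam0) (rhs_le lam0)).
have lhsV_le lam : lhs lam `^ p^-1 <= sup (range rhs) `^ p^-1.
  apply: ge0_ler_powR; rewrite ?nnegrE ?invr_ge0 ?(ltW p_gt0) //.
  exact: le_trans (lhs_rhs lam) (rhs_le lam).
have lhs_ub : has_ubound (range (fun lam => lhs lam `^ p^-1)).
  by exists (sup (range rhs) `^ p^-1) => _ [lam _ <-].
have berE : berezin_norm (sigma_ mu) p T = sup (range (fun lam => lhs lam `^ p^-1)).
  by [].
have ber_ge0 : 0 <= berezin_norm (sigma_ mu) p T.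
  rewrite berE; apply: le_trans (powR_ge0 (lhs lam0) p^-1) _.
  by apply: ub_le_sup => //; exists lam0.
have ber_le : berezin_norm (sigma_ mu) p T <= sup (range rhs) `^ p^-1.
  rewrite berE; apply: ge_sup; first by exists (lhs lam0 `^ p^-1), lam0.
  by move=> _ [lam _ <-].
(* The right side, being nonnegative, is a p-th power, so monotonicity of [p]-th powers reduces the
   goal to [ber_le]. *)
have -> : sup (range rhs) = (sup (range rhs) `^ p^-1) `^ p.
  by rewrite -powRrM mulVf ?powRr1 // gt_eqF.
by apply: ge0_ler_powR; rewrite ?nnegrE ?powR_ge0 ?(ltW p_gt0).
Qed.
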